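(* Let $A$ be a commutative unitary ring and let $f$ be a monic polynomial of degree $n\geq 1$ with coefficients in $A$. Let $A_f=A[\tau_1,\dots,\tau_n]$ be the splitting algebra of $f$ over $A$ with universal roots $\tau_1,\dots,\tau_n$, and let $D_f:=\prod_{1\leq i<j\leq n}(\tau_i+\tau_j)$. Then the elements of $A_f$ that are invariant under the action of $S_n$ are exactly the elements of $A$ (i.e. $A_f^{S_n}=A$) if and only if $\mathrm{Ann}_A\,2\cap \mathrm{Ann}_A\,D_f=0$.
   Context: Construction of the splitting algebra: put $A_n:=A$ and $f_n:=f$; for $i=n,n-1,\dots,1$ let $\tau_i$ be the class of $t$ in $A_i[t]/(f_i)$, set $A_{i-1}:=A_i[\tau_i]=A_i[t]/(f_i)$ and $f_{i-1}:=f_i/(t-\tau_i)$, a monic polynomial of degree $i-1$ over $A_{i-1}$. Then $A_f:=A_0=A[\tau_n,\dots,\tau_1]$ and $f=\prod_{i=1}^n(t-\tau_i)$ in $A_f[t]$. $A_f$ is a free $A$-module with basis $\{\tau_1^{m_1}\cdots\tau_n^{m_n}\mid 0\leq m_i<i\}$; $A$ is regarded as a subring of $A_f$. It has the universal property: for every $A$-algebra $\varphi:A\to B$ such that $\varphi(f)$ splits in $B$ with roots $\nu_1,\dots,\nu_n$ (that is, $\varphi(f)=\prod_i(t-\nu_i)$), there is a unique $A$-algebra homomorphism $A_f\to B$ with $\tau_i\mapsto\nu_i$. The symmetric group $S_n$ acts on $A_f$ by the $A$-algebra automorphisms determined by $\sigma\tau_i=\tau_{\sigma(i)}$, and $A_f^{S_n}$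 is the set of elements fixed by all $\sigma\in S_n$. For $y\in A_f$, $\mathrm{Ann}_A\,y:=\{a\in A\mid ay=0\}$. The element $D_f$ in fact lies in $A$; the empty product is $1$. *)

(* Defs.v *)
From HB Require Import structures.
From mathcomp Require Import all_boot all_order all_fingroup all_algebra.
From mathcomp Require Import qpoly.

Set Implicit Arguments.
Unset Strict Implicit.
Unset Printing Implicit Defensive.

Import GRing.Theory.
Local Open Scope ring_scope.

(* [{poly %/ f}] is A[t]/(f) when f is monic of positive degree (for any other
   f the library makes it A[t]/(t), a case that does not occur below for f
   monic of degree n); [qpolyC f] is its structure map, 'qX the class of t. *)
Definition deflate (A : comNzRingType) (f : {poly A}) : {poly {poly %/ f}} :=
  Pdiv.Ring.rdivp (map_poly (qpolyC f) f) ('X - ('qX)%:P).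

(* With (A_n, f_n) = (A, f), each recursive call goes from (A_i, f_i) to
   (A_(i-1), f_(i-1)); the result A_0 is meaningful for f monic of degree n. *)
Fixpoint splitRing (n : nat) (A : comNzRingType) (f : {poly A}) :
    comNzRingType :=
  if n is m.+1 then splitRing m (deflate f) else A.

Fixpoint splitEmb (n : nat) (A : comNzRingType) (f : {poly A}) :
    {rmorphism A -> splitRing n f} :=
  match n return {rmorphism A -> splitRing n f} with
  | 0 => idfun
  | m.+1 => splitEmb m (deflate f) \o qpolyC f
  end.

(* Indices start at 0: [splitRootR f i] is tau_(i+1). *)
Fixpoint splitRootR (n : nat) (A : comNzRingType) (f : {poly A}) :
    'I_n -> splitRing n f :=
  match n return 'I_n -> splitRing n f with
  | 0 => fun=> 0
  | m.+1 => fun i =>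
      if unlift ord_max i is Some j then splitRootR (deflate f) j
      else splitEmb m (deflate f) 'qX
  end.

(* The map given by the universal property: phi on A, and tau_(i+1) |-> nu i.
   It is a ring morphism when map_poly phi f = \prod_i ('X - (nu i)%:P). *)
Fixpoint splitLiftR (n : nat) (A : comNzRingType) (f : {poly A})
    (B : comNzRingType) (phi : A -> B) : ('I_n -> B) -> splitRing n f -> B :=
  match n return ('I_n -> B) -> splitRing n f -> B with
  | 0 => fun=> phi
  | m.+1 => fun nu =>
      splitLiftR (fun p : {poly %/ f} => (map_poly phi p).[nu ord_max])
                 (fun j => nu (lift ord_max j))
  end.

Definition splitAlg (n : nat) (A : comNzRingType) (f : {poly A}) : Type :=
  splitRing n f.

HB.instance Definition _ (n : nat) (A : comNzRingType) (f : {poly A}) :=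
  GRing.ComNzRing.on (splitAlg n f).

Section AlgebraStructure.
Variables (n : nat) (A : comNzRingType) (f : {poly A}).

Let scale (a : A) (x : splitAlg n f) : splitAlg n f :=
  (splitEmb n f a : splitAlg n f) * x.

Fact splitAlg_scalerA a b x : scale a (scale b x) = scale (a * b) x.
Proof. by rewrite /scale mulrA -rmorphM. Qed.

Fact splitAlg_scale1r : left_id 1 scale.
Proof. by move=> x; rewrite /scale rmorph1 mul1r. Qed.

Fact splitAlg_scalerDr : right_distributive scale +%R.
Proof. by move=> a x y; rewrite /scale mulrDr. Qed.

Fact splitAlg_scalerDl x : {morph scale^~ x : a b / a + b}.
Proof. by move=> a b; rewrite /scale rmorphD mulrDl. Qed.

HB.instance Definition _ := GRing.Zmodule_isLmodule.Build A (splitAlg n f)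
  splitAlg_scalerA splitAlg_scale1r splitAlg_scalerDr splitAlg_scalerDl.

Fact splitAlg_scalerAl a (x y : splitAlg n f) : a *: (x * y) = (a *: x) * y.
Proof. by rewrite /GRing.scale /= /scale mulrA. Qed.

HB.instance Definition _ := GRing.Lmodule_isLalgebra.Build A (splitAlg n f)
  splitAlg_scalerAl.
HB.instance Definition _ := GRing.Lalgebra_isComAlgebra.Build A (splitAlg n f).

Lemma splitAlg_algE a : a%:A = splitEmb n f a :> splitAlg n f.
Proof. exact: mulr1. Qed.

End AlgebraStructure.

Definition splitRoot (n : nat) (A : comNzRingType) (f : {poly A}) :
  'I_n -> splitAlg n f := @splitRootR n A f.

Definition splitLift (n : nat) (A : comNzRingType) (f : {poly A})
    (B : comAlgType A) (nu : 'I_n -> B) : splitAlg n f -> B :=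
  splitLiftR (in_alg B) nu.

(* The A-algebra endomorphism of A_f sending tau_i to tau_(s(i)). *)
Definition splitAct (n : nat) (A : comNzRingType) (f : {poly A}) (s : 'S_n) :
    splitAlg n f -> splitAlg n f :=
  splitLift (fun i => splitRoot f (s i)).

Definition splitInvariant (n : nat) (A : comNzRingType) (f : {poly A})
    (x : splitAlg n f) : Prop :=
  forall s : 'S_n, splitAct s x = x.

Definition splitD (n : nat) (A : comNzRingType) (f : {poly A}) : splitAlg n f :=
  \prod_(i < n) \prod_(j < n | (i < j)%N) (splitRoot f i + splitRoot f j).

Definition Ann (A : comNzRingType) (M : lmodType A) (y : M) (a : A) : Prop :=
  a *: y = 0.

Section Deflate.
Variables (A : comNzRingType) (f : {poly A}).
Hypotheses (f_monic : f \is monic) (f_gt1 : (1 < size f)%N).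

Lemma horner_qpolyX (p : {poly A}) :
  (map_poly (qpolyC f) p).['qX] = in_qpoly f p.
Proof.
elim/poly_ind: p => [|p c IHp]; first by rewrite rmorph0 horner0 rmorph0.
rewrite rmorphD rmorphM /= map_polyX map_polyC hornerMXaddC IHp.
rewrite in_qpolyD in_qpolyM; congr (_ + _); apply: val_inj => /=.
by rewrite Pdiv.Ring.rmodp_small // (size_mk_monic (qpolyC f c)).
Qed.

Lemma deflateE : map_poly (qpolyC f) f = deflate f * ('X - ('qX)%:P).
Proof.
have mk_f : mk_monic f = f by rewrite /mk_monic f_gt1 f_monic.
have /factor_theorem[q fE] : root (map_poly (qpolyC f) f) 'qX.
  apply/rootP; rewrite horner_qpolyX; apply: val_inj => /=.
  by rewrite mk_f Pdiv.RingMonic.rmodpp.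
by rewrite /deflate {1}fE fE Pdiv.RingMonic.rdivp_mull // monicXsubC.
Qed.

Lemma deflate_monic : deflate f \is monic.
Proof.
by rewrite -(monicMr _ (monicXsubC 'qX)) -deflateE monic_map.
Qed.

Lemma size_deflate : size (deflate f) = (size f).-1.
Proof.
have := size_Mmonic (monic_neq0 deflate_monic) (monicXsubC 'qX).
rewrite -deflateE size_XsubC addn2 /= size_map_poly_id0 => [->//|].
by rewrite (monicP f_monic) rmorph1 oner_neq0.
Qed.

End Deflate.

Section UniversalProperty.

Lemma splitRingP (n : nat) (A : comNzRingType) (f : {poly A}) :
    f \is monic -> size f = n.+1 ->
  map_poly (splitEmb n f) f = \prod_i ('X - (splitRootR f i)%:P).
Proof.
elim: n A f => [|n IHn] A f f_monic f_size.
  rewrite big_ord0 map_poly_id => [|x _]//.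
  have /eqP/size_poly1P[c _ fE] := f_size.
  by move: f_monic; rewrite fE monicE lead_coefC => /eqP->.
have f_gt1 : (1 < size f)%N by rewrite f_size.
rewrite map_poly_comp deflateE // rmorphM /= IHn ?deflate_monic //.
  rewrite rmorphB /= map_polyX map_polyC /= big_ord_recr /= unlift_none.
  congr (_ * _); apply: eq_bigr => i _.
  have -> : widen_ord (leqnSn n) i = lift ord_max i.
    by apply: val_inj; rewrite /= /bump leqNgt ltn_ord.
  by rewrite liftK.
by rewrite size_deflate ?f_size.
Qed.

Lemma splitLiftR_correct (n : nat) (A B : comNzRingType) (f : {poly A})
    (phi : {rmorphism A -> B}) (nu : 'I_n -> B) :
    f \is monic -> size f = n.+1 ->
    map_poly phi f = \prod_i ('X - (nu i)%:P) ->
  [/\ zmod_morphism (splitLiftR (f := f) phi nu),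
      monoid_morphism (splitLiftR (f := f) phi nu),
      forall a, splitLiftR (f := f) phi nu (splitEmb n f a) = phi a
    & forall i, splitLiftR (f := f) phi nu (splitRootR f i) = nu i].
Proof.
elim: n A f phi nu => [|n IHn] A f phi nu f_monic f_size fE.
  split=> //; [exact: rmorphB | by split; [exact: rmorph1 | exact: rmorphM] |].
  by case.
have f_gt1 : (1 < size f)%N by rewrite f_size.
have mk_f : mk_monic f = f by rewrite /mk_monic f_gt1 f_monic.
pose psi (p : {poly %/ f}) := (map_poly phi p).[nu ord_max].
have nuE i : widen_ord (leqnSn n) i = lift ord_max i.
  by apply: val_inj; rewrite /= /bump leqNgt ltn_ord.
have f_nu : (map_poly phi f).[nu ord_max] = 0.
  by rewrite fE big_ord_recr /= hornerM hornerXsubC subrr mulr0.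
have psi_mod p : (map_poly phi (Pdiv.Ring.rmodp p (mk_monic f))).[nu ord_max]
                 = (map_poly phi p).[nu ord_max].
  rewrite mk_f [in RHS](Pdiv.RingMonic.rdivp_eq f_monic p) rmorphD rmorphM hornerD.
  by rewrite hornerM f_nu mulr0 add0r.
have psiB : zmod_morphism psi.
  by move=> p q; rewrite /psi /= rmorphB hornerD hornerN.
have psiM : monoid_morphism psi.
  split=> [|p q]; rewrite /psi; first by rewrite rmorph1 hornerC.
  by rewrite poly_of_qpolyM psi_mod rmorphM hornerM.
pose psiBI := GRing.isZmodMorphism.Build _ _ psi psiB.
pose psiMI := GRing.isMonoidMorphism.Build _ _ psi psiM.
pose Psi : {rmorphism {poly %/ f} -> B} :=
  HB.pack psi psiBI psiMI.
have psiC a : psi (qpolyC f a) = phi a by rewrite /psi /= map_polyC hornerC.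
have psiX : psi 'qX = nu ord_max.
  by rewrite /psi /= psi_mod map_polyX hornerX.
have dE : map_poly Psi (deflate f) = \prod_i ('X - (nu (lift ord_max i))%:P).
  apply: (monic_rreg (monicXsubC (nu ord_max))).
  transitivity (map_poly Psi (map_poly (qpolyC f) f)).
    have /= XE := map_polyX Psi; have /= CE := map_polyC Psi 'qX.
    rewrite deflateE // (rmorphM (map_poly Psi)) (rmorphB (map_poly Psi)) /=.
    by rewrite XE CE psiX.
  rewrite -map_poly_comp (@eq_map_poly _ _ _ phi) => [|a]; last exact: psiC.
  rewrite fE big_ord_recr /=; congr (_ * _).
  by apply: eq_bigr => i _; rewrite nuE.
have [| |liftB liftM liftC liftX] := IHn _ _ Psi _ _ _ dE.
- exact: deflate_monic.
- by rewrite size_deflate ?f_size.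
split=> // [a|i] /=; first by rewrite liftC /= psiC.
case: unliftP => [j|] ->; first exact: liftX.
by rewrite liftC /= psiX.
Qed.

Lemma splitRing_uniq (n : nat) (A B : comNzRingType) (f : {poly A})
    (g h : {rmorphism splitRing n f -> B}) :
    (forall a, g (splitEmb n f a) = h (splitEmb n f a)) ->
    (forall i, g (splitRootR f i) = h (splitRootR f i)) -> g =1 h.
Proof.
elim: n A f g h => [|n IHn] A f g h ghC ghX; first exact: ghC.
apply: IHn => [p|i]; last first.
  by have := ghX (lift ord_max i); rewrite /= liftK.
have -> : p = (map_poly (qpolyC f) p).['qX].
  rewrite horner_qpolyX; apply: val_inj => /=.
  by rewrite Pdiv.Ring.rmodp_small // size_mk_monic.
rewrite -!horner_map -!map_poly_comp /=.
have := ghX ord_max; rewrite /= unlift_none => ->.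
by congr (_.[_]); apply: eq_map_poly => a; exact: ghC.
Qed.

Variables (n : nat) (A : comNzRingType) (f : {poly A}).
Hypotheses (f_monic : f \is monic) (f_size : size f = n.+1).

Lemma splitAlgP :
  map_poly (in_alg (splitAlg n f)) f = \prod_i ('X - (splitRoot f i)%:P).
Proof.
rewrite -[RHS](splitRingP f_monic f_size).
by apply: eq_map_poly => a; rewrite /= splitAlg_algE.
Qed.

Lemma splitLift_existence (B : comAlgType A) (nu : 'I_n -> B) :
    map_poly (in_alg B) f = \prod_i ('X - (nu i)%:P) ->
  {g : {lrmorphism splitAlg n f -> B} |
    g =1 splitLift nu & forall i, g (splitRoot f i) = nu i}.
Proof.
case/(splitLiftR_correct f_monic f_size) => liftB liftM liftC liftX.
have liftZ : scalable (splitLift nu : splitAlg n f -> B).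
  move=> a x; rewrite -[a *: x]mulr_algl splitAlg_algE.
  by rewrite /splitLift liftM.2 liftC /= mulr_algl.
pose gB := GRing.isZmodMorphism.Build (splitAlg n f) B (splitLift nu) liftB.
pose gM := GRing.isMonoidMorphism.Build (splitAlg n f) B (splitLift nu) liftM.
pose gZ := GRing.isScalable.Build A (splitAlg n f) B *:%R (splitLift nu) liftZ.
pose g : {lrmorphism splitAlg n f -> B} := HB.pack (splitLift nu) gB gM gZ.
by exists g.
Qed.

Lemma splitAlg_uniq (B : comAlgType A) (g h : {lrmorphism splitAlg n f -> B}) :
  (forall i, g (splitRoot f i) = h (splitRoot f i)) -> g =1 h.
Proof.
move=> gh; apply: (@splitRing_uniq n A B f g h) => [a|]; last exact: gh.
have kC (k : {lrmorphism splitAlg n f -> B}) : k (splitEmb n f a) = a%:A.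
  by rewrite -splitAlg_algE rmorph_alg.
by rewrite [LHS]kC [RHS]kC.
Qed.

Lemma splitAct_existence (s : 'S_n) :
  {g : {lrmorphism splitAlg n f -> splitAlg n f} |
    g =1 splitAct s & forall i, g (splitRoot f i) = splitRoot f (s i)}.
Proof.
apply: splitLift_existence; rewrite splitAlgP.
exact: (reindex_inj (@perm_inj _ s)).
Qed.

End UniversalProperty.

(* Main.v *)
Require Import Defs.
From HB Require Import structures.
From mathcomp Require Import all_boot all_order all_fingroup all_algebra.
From mathcomp Require Import qpoly ring.
From mathcomp Require mpoly.
Import GRing.Theory.
Local Open Scope ring_scope.

Set Implicit Arguments.
Unset Strict Implicit.
Unset Printing Implicit Defensive.

(** Write A_f for the splitting algebra and tau_i for its universal roots.

    If Ann 2 and Ann D_f meet trivially, invariants descend the tower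
    A = A_n, A_(n-1), ..., A_0 = A_f.  By induction (the hypothesis passes from
    A to A[tau_n], because D_f lies in A and A[tau_n] is free over A) an
    invariant equals p(tau_n) with p in A[t] of degree less than n.  Exchanging
    tau_n and tau_(n-1) gives p(tau_(n-1)) = p(tau_n), so that p(t) - p(tau_n)
    is a multiple b * f_(n-1) with b the coefficient of t^(n-1) in p.  Comparing
    coefficients yields b = 0 when n >= 3, and 2 b = b D_f = 0 when n = 2; then
    p is constant ([fixed_in_base]).

    Conversely let A_f^(S_n) = A and let c <> 0 in C := A_f be killed by 2 and
    by D_f.  A nonzero multiple of c is killed by a single factor
    tau_i + tau_j of D_f, hence by tau_i - tau_j.  Consider the splitting
    algebra W of f over C, with new roots rho_i; its S_n-invariants are the
    elements of C ([fixed_base_change]).  Each ordering y of the roots tau_j of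
    f in C gives the product Z(y) of the rho_i - y_j over j < i (the double
    Schubert polynomial of the longest permutation).  It satisfies
    q(rho) Z(y) = q(y) Z(y) for every polynomial q, and exchanging two adjacent
    roots rho has the same effect on it as exchanging the two corresponding
    entries of y, up to the sign ([staircase_root], [staircase_swap]).

    Identify the tau_i that become equal after multiplication by c, and let
    y run over the resulting distinct orderings.  Since 2 c = 0, the element
    c * sum_y Z(y) is invariant, so it is some d in C.  Multiply it by a product
    x of differences rho_i - tau_k that vanishes at all orderings but one, y0,
    and that involves only rho_3, ..., rho_n (possible because two of the
    roots are identified).  Then d x = c x(y0) Z(y0).  The coefficient of
    the top monomial of the basis (rho^m), 0 <= m_i < i, is 0 on the left and
    c x(y0) on the right ([splitTop_low], [splitTop_monic]), so c x(y0) = 0.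
    As x(y0) is a product of differences tau_i - tau_k none of which kills c,
    some nonzero multiple of c is killed by strictly more differences than
    c is ([orbit_step]).  There are finitely many differences, so this cannot
    go on forever ([annihilator_split]). *)

Local Notation splitDR n f := (\prod_(i < n) \prod_(j < n | (i < j)%N)
  (splitRootR f i + splitRootR f j)).

(** * The splitting algebra as a tower *)

Lemma widen_ord_lift (n : nat) (i : 'I_n) :
  widen_ord (leqnSn n) i = lift ord_max i.
Proof. by apply: val_inj; rewrite /= /bump leqNgt ltn_ord. Qed.

Lemma mk_monicE (A : comNzRingType) (f : {poly A}) :
  f \is monic -> (1 < size f)%N -> mk_monic f = f.
Proof. by move=> f_monic f_gt1; rewrite /mk_monic f_gt1 f_monic. Qed.

Lemma size_qpoly (A : comNzRingType) (f : {poly A}) (p : {poly %/ f}) :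
  f \is monic -> (1 < size f)%N -> (size p < size f)%N.
Proof.
move=> f_monic f_gt1.
by have := size_mk_monic p; rewrite {2}(mk_monicE f_monic f_gt1).
Qed.

Lemma qpolyC_inj (A : comNzRingType) (f : {poly A}) : injective (qpolyC f).
Proof. by move=> a b /(congr1 val)/polyC_inj. Qed.

Lemma splitEmb_inj (n : nat) (A : comNzRingType) (f : {poly A}) :
  injective (splitEmb n f).
Proof.
elim: n A f => [|n IHn] A f; first by move=> a b.
by move=> a b /IHn/qpolyC_inj.
Qed.

Lemma splitRootR_max (n : nat) (A : comNzRingType) (f : {poly A}) :
  splitRootR f (ord_max : 'I_n.+1) = splitEmb n (deflate f) 'qX.
Proof. by rewrite /= unlift_none. Qed.

Lemma splitRootR_lift (n : nat) (A : comNzRingType) (f : {poly A}) (j : 'I_n) :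
  splitRootR f (lift ord_max j) = splitRootR (deflate f) j.
Proof. by rewrite /= liftK. Qed.

Lemma splitRing_lift (n : nat) (A B : comNzRingType) (f : {poly A})
    (phi : {rmorphism A -> B}) (nu : 'I_n -> B) :
    f \is monic -> size f = n.+1 ->
    map_poly phi f = \prod_i ('X - (nu i)%:P) ->
  {h : {rmorphism splitRing n f -> B} |
    (forall a, h (splitEmb n f a) = phi a) &
    (forall i, h (splitRootR f i) = nu i)}.
Proof.
move=> f_monic f_size /(splitLiftR_correct f_monic f_size) [hB hM hC hX].
pose hBI := GRing.isZmodMorphism.Build _ _ (splitLiftR (f := f) phi nu) hB.
pose hMI := GRing.isMonoidMorphism.Build _ _ (splitLiftR (f := f) phi nu) hM.
pose h : {rmorphism splitRing n f -> B} :=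
  HB.pack (splitLiftR (f := f) phi nu) hBI hMI.
by exists h.
Qed.

Lemma splitRing_perm (n : nat) (A : comNzRingType) (f : {poly A}) (s : 'S_n) :
    f \is monic -> size f = n.+1 ->
  {h : {rmorphism splitRing n f -> splitRing n f} |
    (forall a, h (splitEmb n f a) = splitEmb n f a) &
    (forall i, h (splitRootR f i) = splitRootR f (s i))}.
Proof.
move=> f_monic f_size; apply: splitRing_lift => //.
by rewrite splitRingP //; apply: (reindex_inj (@perm_inj _ s)).
Qed.

(** Invariance tested on all ring endomorphisms over A that permute the roots
    by s, rather than on the action itself: such an endomorphism of the ring
    [splitRing n.+1 f] is at once one of [splitRing n (deflate f)] over
    A[t]/(f), which makes the notion easy to restrict along the tower. *)
Definition permFixed (n : nat) (A : comNzRingType) (f : {poly A})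
    (x : splitRing n f) : Prop :=
  forall (s : 'S_n) (h : {rmorphism splitRing n f -> splitRing n f}),
    (forall a, h (splitEmb n f a) = splitEmb n f a) ->
    (forall i, h (splitRootR f i) = splitRootR f (s i)) -> h x = x.

Lemma lrmorph_splitEmb (n : nat) (A : comNzRingType) (f : {poly A})
    (g : {lrmorphism splitAlg n f -> splitAlg n f}) (a : A) :
  g (splitEmb n f a) = splitEmb n f a.
Proof. by have := rmorph_alg g a; rewrite splitAlg_algE. Qed.

Lemma splitInvariantE (n : nat) (A : comNzRingType) (f : {poly A})
    (x : splitAlg n f) :
  f \is monic -> size f = n.+1 -> splitInvariant x <-> permFixed (f := f) x.
Proof.
move=> f_monic f_size; split=> [xP s h hC hX | xP s].
  have [g gE gX] := splitAct_existence f_monic f_size s.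
  rewrite -[RHS](xP s) -gE.
  apply: (@splitRing_uniq n A _ f h g) => [a | i].
    by rewrite hC; apply/esym/lrmorph_splitEmb.
  by rewrite hX [RHS]gX.
have [g gE gX] := splitAct_existence f_monic f_size s.
rewrite -gE; apply: (xP s g) => // a; apply: lrmorph_splitEmb.
Qed.

(** * Symmetric functions of the roots *)

Section SymmetricFunctions.
Import mpoly.

Lemma prod_pairs_perm (n : nat) (R : comNzRingType) (F : 'I_n -> 'I_n -> R)
    (s : 'S_n) : (forall i j, F i j = F j i) ->
  \prod_(i < n) \prod_(j < n | (i < j)%N) F (s i) (s j)
  = \prod_(i < n) \prod_(j < n | (i < j)%N) F i j.
Proof.
move=> FC; rewrite !pair_big_dep /=.
pose sort_pair (p : 'I_n * 'I_n) := if (p.1 < p.2)%N then p else (p.2, p.1).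
pose h (t : 'S_n) p := sort_pair (t p.1, t p.2).
have hK (t : 'S_n) (p : 'I_n * 'I_n) : (p.1 < p.2)%N -> h t (h t^-1%g p) = p.
  case: p => i j lt_ij; rewrite /h /sort_pair /=.
  case: (ltnP (t^-1%g i)) => _ /=; rewrite !permKV ?lt_ij //.
  by rewrite ltnNge (ltnW lt_ij).
have hlt (t : 'S_n) (p : 'I_n * 'I_n) : (p.1 < p.2)%N -> ((h t p).1 < (h t p).2)%N.
  case: p => i j lt_ij; rewrite /h /sort_pair /=; case: ifP => //= /negbT.
  rewrite -leqNgt leq_eqVlt => /orP [/eqP/val_inj/perm_inj eq_ij|//].
  by move: lt_ij; rewrite /= eq_ij ltnn.
rewrite [RHS](reindex_onto (h s) (h s^-1%g)) /=; last first.
  by move=> p; apply: hK.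
apply: eq_big => [[i j]|[i j] /= lt_ij]; last first.
  by rewrite /h /sort_pair /=; case: ifP.
apply/idP/idP => [lt_ij|/andP [lt_h /eqP <-]]; last exact: hlt.
by rewrite hlt //=; apply/eqP; rewrite -{2}[s]invgK hK.
Qed.

(** The fundamental theorem of symmetric polynomials reduces to the elementary
    ones, and these are the coefficients of f up to sign. *)
Lemma symmetric_in_base (n : nat) (A : comNzRingType) (f : {poly A})
    (p : {mpoly int[n]}) :
    f \is monic -> size f = n.+1 -> p \is symmetric ->
  exists a, mmap intr (splitRootR f) p = splitEmb n f a.
Proof.
move=> f_monic f_size /sym_fundamental [t [<- _]].
pose ev : {rmorphism {mpoly int[n]} -> _} := mmap intr (splitRootR f).
pose e (k : 'I_n) : A := (-1) ^+ k.+1 * f`_(n - k.+1).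
exists (mmap intr e t).
have evS (k : 'I_n) : ev (mesym n int k.+1) = splitEmb n f (e k).
  have: map_poly ev (\prod_(i < n) ('X - ('X_i)%:P)) = map_poly (splitEmb n f) f.
    rewrite splitRingP // rmorph_prod; apply: eq_bigr => i _.
    by rewrite rmorphB /= map_polyX map_polyC /= mmapX mmap1U.
  rewrite Viete => /(congr1 (fun q : {poly _} => q`_(n - k.+1))).
  rewrite /e rmorphM rmorphXn rmorphN1 -coef_map => <- /=.
  rewrite coef_map /= coef_sum.
  rewrite (bigD1 (lift ord0 k)) //= big1 ?addr0 => [|i]; last first.
    rewrite -val_eqE /= /bump leq0n add1n => ne_ik.
    rewrite !coefZ coefXn eqn_sub2lE ?ltn_ord // -1?ltnS ?ltn_ord //.
    by rewrite eq_sym (negPf ne_ik) !mulr0.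
  rewrite /bump leq0n add1n !coefZ coefXn eqxx mulr1.
  by rewrite rmorphM rmorphXn rmorphN1 mulrA -expr2 sqrr_sign mul1r.
rewrite -[LHS]/(ev _) comp_mpolyEX [in RHS]/mmap !rmorph_sum /=.
apply: eq_bigr => m _; rewrite mmapZ comp_mpolyX rmorphM rmorph_int.
rewrite !rmorph_prod; congr (_ * _); apply: eq_bigr => i _.
by rewrite !rmorphXn tnth_mktuple; congr (_ ^+ _); apply: evS.
Qed.

Lemma splitD_in_base (n : nat) (A : comNzRingType) (f : {poly A}) :
    f \is monic -> size f = n.+1 ->
  exists d, splitDR n f = splitEmb n f d.
Proof.
move=> f_monic f_size.
pose p : {mpoly int[n]} :=
  \prod_(i < n) \prod_(j < n | (i < j)%N) ('X_i + 'X_j).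
have p_sym : p \is symmetric.
  apply/issymP => s; rewrite -[RHS](prod_pairs_perm s) => [|i j]; last exact: addrC.
  rewrite rmorph_prod; apply: eq_bigr => i _.
  rewrite rmorph_prod; apply: eq_bigr => j _.
  by rewrite rmorphD /= /msym !mmapX !mmap1U.
have [d dE] := symmetric_in_base f_monic f_size p_sym.
exists d; rewrite -dE rmorph_prod; apply: eq_bigr => i _.
rewrite rmorph_prod; apply: eq_bigr => j _.
by rewrite rmorphD /= !mmapX !mmap1U.
Qed.
End SymmetricFunctions.

(** * Descent of invariants along the tower *)

Lemma rmodp_eq0_small (A : comNzRingType) (f h : {poly A}) :
    f \is monic -> (size h <= size f)%N -> Pdiv.Ring.rmodp h f = 0 ->
  h = h`_(size f).-1 *: f.
Proof.
move=> f_monic le_hf h_mod; apply/eqP; rewrite -subr_eq0; apply/eqP.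
set q := h - _; have f_gt0 : (0 < size f)%N by rewrite size_poly_gt0 monic_neq0.
rewrite -(@Pdiv.Ring.rmodp_small _ q f); last first.
  rewrite -(prednK f_gt0) ltnS; apply/leq_sizeP => j.
  rewrite leq_eqVlt => /orP [/eqP <-|lt_j].
    by rewrite coefB coefZ -lead_coefE (monicP f_monic) mulr1 subrr.
  have lt_fj : (size f <= j)%N by rewrite -(prednK f_gt0).
  rewrite coefB coefZ (nth_default _ lt_fj).
  by rewrite (nth_default _ (leq_trans le_hf lt_fj)) mulr0 subrr.
rewrite /q Pdiv.RingMonic.rmodpB // Pdiv.RingMonic.rmodpZ //.
by rewrite h_mod Pdiv.RingMonic.rmodpp // scaler0 subrr.
Qed.

Section FixedInBase.
Variables (A : comNzRingType) (f : {poly A}).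
Hypotheses (f_monic : f \is monic).

Lemma coef_deflate (k : nat) : size f = k.+2 ->
  (deflate f)`_k = 1.
Proof.
move=> f_size; have f_gt1 : (1 < size f)%N by rewrite f_size.
have /monicP := deflate_monic f_monic f_gt1.
by rewrite lead_coefE size_deflate // f_size.
Qed.

Lemma coef_deflate_pred (k : nat) : size f = k.+3 ->
  (deflate f)`_k = qpolyC f f`_k.+1 + 'qX.
Proof.
move=> f_size; have f_gt1 : (1 < size f)%N by rewrite f_size.
have /(congr1 (fun q : {poly _} => q`_k.+1)) := deflateE f_monic f_gt1.
rewrite mulrBr coefB coefMX coefMC coef_map /= => ->.
by rewrite (@coef_deflate k.+1) // mul1r subrK.
Qed.

End FixedInBase.

Lemma qpoly_decomp (A : comNzRingType) (f : {poly A}) (p : {poly %/ f}) :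
  (map_poly (qpolyC f) p).['qX] = p.
Proof.
rewrite horner_qpolyX; apply: val_inj => /=.
by rewrite Pdiv.Ring.rmodp_small // size_mk_monic.
Qed.

Lemma coef_qpolyCM (A : comNzRingType) (f : {poly A}) (a : A)
  (p : {poly %/ f}) k : (qpolyC f a * p : {poly %/ f})`_k = a * p`_k.
Proof.
rewrite poly_of_qpolyM Pdiv.Ring.rmodp_small /= mul_polyC ?coefZ //.
exact: leq_ltn_trans (size_scale_leq _ _) (size_mk_monic p).
Qed.

Lemma qpolyC_addX (A : comNzRingType) (f : {poly A}) (a : A) :
    f \is monic -> (2 < size f)%N ->
  qpolyC f a + 'qX = a%:P + 'X :> {poly A}.
Proof. by move=> f_monic f_gt2; rewrite poly_of_qpolyD qpolyXE. Qed.

Lemma splitD_deflate (n : nat) (A : comNzRingType) (f : {poly A}) :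
  splitDR n.+1 f = splitDR n (deflate f)
    * \prod_(i < n) (splitRootR (deflate f) i + splitEmb n (deflate f) 'qX).
Proof.
rewrite big_ord_recr /= [X in _ * X]big1 ?mulr1 => [|j]; last first.
  by rewrite ltnNge -ltnS ltn_ord.
rewrite -big_split; apply: eq_bigr => i _.
rewrite big_mkcond big_ord_recr /= ltn_ord -big_mkcond /=.
rewrite unlift_none !widen_ord_lift liftK; congr (_ * _).
by apply: eq_bigr => j _; rewrite widen_ord_lift liftK.
Qed.

Lemma horner_in_qpoly (B W : comNzRingType) (g : {poly B})
    (e : {rmorphism {poly %/ g} -> W}) (P : {poly B}) :
  (map_poly (e \o qpolyC g) P).[e 'qX] = e (in_qpoly g P).
Proof. by rewrite -horner_qpolyX -horner_map -map_poly_comp. Qed.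

(** The endomorphism sends P(x) to P(t), where t is the class of the variable
    in B[t]/(g), and B[t]/(g) embeds in the splitting algebra. *)
Lemma splitEmb_fixed_horner (m : nat) (B : comNzRingType) (g P : {poly B})
    (act : {rmorphism splitRing m.+1 g -> splitRing m.+1 g}) (x : B) :
    (forall i, act (splitEmb m.+1 g P`_i) = splitEmb m.+1 g P`_i) ->
    act (splitEmb m.+1 g x) = splitRootR g ord_max ->
    act (splitEmb m.+1 g P.[x]) = splitEmb m.+1 g P.[x] ->
  in_qpoly g P = qpolyC g P.[x].
Proof.
move=> actC actX act_p; apply: (@splitEmb_inj m _ (deflate g)).
rewrite -horner_in_qpoly -splitRootR_max -actX.
rewrite -[RHS]act_p -!horner_map; congr horner.
by apply/polyP => i; rewrite !coef_map; apply: esym (actC i).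
Qed.

(** The types of the two endomorphisms are convertible; hiding the witness
    behind an existential keeps the conversion test from unfolding the tower. *)
Lemma splitRingS_endo (n : nat) (A : comNzRingType) (f : {poly A})
    (act : {rmorphism splitRing n.+1 f -> splitRing n.+1 f}) :
  exists act' : {rmorphism splitRing n (deflate f) -> splitRing n (deflate f)},
    forall x, act' x = act x.
Proof. by exists act. Qed.

(** The invariance under the exchange of the last two roots tau_n and
    tau_(n-1) reads p(tau_(n-1)) = p(tau_n), and tau_(n-1) is the class of t
    modulo f_(n-1) = [deflate f]. *)
Lemma fixed_qpoly_mod (m : nat) (A : comNzRingType) (f : {poly A})
    (p : {poly %/ f}) :
    f \is monic -> size f = m.+3 ->
    permFixed (f := f) (splitEmb m.+1 (deflate f) p : splitRing m.+2 f) ->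
  Pdiv.Ring.rmodp (map_poly (qpolyC f) p - p%:P) (deflate f) = 0.
Proof.
move=> f_monic f_size p_fixed.
have f_gt1 : (1 < size f)%N by rewrite f_size.
have g_monic := deflate_monic f_monic f_gt1.
have g_size : size (deflate f) = m.+2 by rewrite size_deflate // f_size.
pose s : 'S_m.+2 := tperm ord_max (lift ord_max ord_max).
have [act0 actC0 actX0] := splitRing_perm s f_monic f_size.
have act_p0 := p_fixed s act0 actC0 actX0.
have [act act0E] := splitRingS_endo act0.
have actC i : act (splitEmb m.+1 (deflate f) (map_poly (qpolyC f) p)`_i)
    = splitEmb m.+1 (deflate f) (map_poly (qpolyC f) p)`_i.
  by rewrite coef_map act0E; apply: actC0.
have actX : act (splitEmb m.+1 (deflate f) 'qX)
    = splitRootR (deflate f) ord_max.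
  rewrite act0E; have := actX0 ord_max.
  by rewrite tpermL splitRootR_lift {1}splitRootR_max.
have act_p : act (splitEmb m.+1 (deflate f) (map_poly (qpolyC f) p).['qX])
    = splitEmb m.+1 (deflate f) (map_poly (qpolyC f) p).['qX].
  by rewrite qpoly_decomp act0E.
have := splitEmb_fixed_horner actC actX act_p.
rewrite qpoly_decomp.
move/(congr1 val); rewrite /= (mk_monicE g_monic) ?g_size // => p_mod.
rewrite Pdiv.RingMonic.rmodpB // p_mod Pdiv.Ring.rmodp_small ?subrr //.
by rewrite g_size (leq_ltn_trans (size_polyC_leq1 _)).
Qed.

(** Let n = m + 2 be the degree of f and tau the class of t modulo f.  By degree,
    p(t) - p(tau) = b f_(n-1)(t) with b the coefficient of t^(n-1) in p.
    The coefficient of t^m on the right is b (f_(m+1) + tau).  The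
    coefficient of tau in it is b, to be compared with that of p_m, namely 0, if
    m > 0, and with that of p_0 - p(tau), namely - b, if m = 0. *)
Lemma fixed_qpolyE (m : nat) (A : comNzRingType) (f : {poly A})
    (p : {poly %/ f}) :
    f \is monic -> size f = m.+3 ->
    Pdiv.Ring.rmodp (map_poly (qpolyC f) p - p%:P) (deflate f) = 0 ->
  [/\ p`_m.+1 = 0 -> p = qpolyC f p`_0,
      p`_m.+1 *+ 2 = 0 & (0 < m)%N -> p`_m.+1 = 0].
Proof.
move=> f_monic f_size; set h := _ - _ => h_mod.
have f_gt1 : (1 < size f)%N by rewrite f_size.
have p_size := size_qpoly p f_monic f_gt1.
have g_monic := deflate_monic f_monic f_gt1.
have g_size : size (deflate f) = m.+2 by rewrite size_deflate // f_size.
have h_coef i : h`_i.+1 = qpolyC f p`_i.+1.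
  by rewrite coefB coefC /= subr0 coef_map.
have h_size : (size h <= size (deflate f))%N.
  apply/leq_sizeP => -[|j]; rewrite g_size // => le_mj.
  rewrite h_coef nth_default ?rmorph0 // -ltnS.
  by rewrite (leq_trans p_size) // f_size.
have := rmodp_eq0_small g_monic h_size h_mod; rewrite g_size /= h_coef.
set b := p`_m.+1 => hE.
have := congr1 (fun q : {poly {poly %/ f}} => (q`_m : {poly %/ f})`_1) hE.
rewrite coefZ coef_deflate_pred // coef_qpolyCM qpolyC_addX ?f_size //.
rewrite coefD coefC coefX add0r mulr1 => hm.
have m_gt0 : (0 < m)%N -> b = 0.
  by case: (m) hm => // k; rewrite h_coef qpolyCE coefC.
have b2 : b *+ 2 = 0.
  case: (posnP m) => [m0|/m_gt0 ->]; last by rewrite mul0rn.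
  move: hm; rewrite m0 coefB coefC coef_map coefB /= coefC add0r /b m0 => /eqP.
  by rewrite eq_sym -addr_eq0 => /eqP.
split=> // b0; apply: val_inj; apply/polyP => -[|k]; rewrite /= coefC //=.
apply: (@qpolyC_inj _ f).
by rewrite -h_coef hE b0 rmorph0 scale0r coef0.
Qed.

(** For n = 2, exchanging the roots of p_0 + b tau_2 gives
    b (tau_2 - tau_1) = 0, which is b D_f = 0 as 2 b = 0. *)
Lemma fixed_quadratic (A : comNzRingType) (f : {poly A}) (p : {poly %/ f}) :
    f \is monic -> size f = 3%N ->
    permFixed (f := f) (splitEmb 1 (deflate f) p : splitRing 2 f) ->
    p`_1 *+ 2 = 0 ->
  splitEmb 2 f p`_1 * splitDR 2%N f = 0.
Proof.
move=> f_monic f_size p_fixed; set b := p`_1 => b2.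
have p_size : (size p <= 2)%N.
  by rewrite -ltnS -f_size size_qpoly ?f_size.
pose s : 'S_2 := tperm ord_max (lift ord_max ord_max).
have [act actC actX] := splitRing_perm s f_monic f_size.
have act_p := p_fixed s act actC actX.
have pE : splitEmb 1 (deflate f) p
    = splitEmb 2 f p`_0 + splitEmb 2 f b * splitRootR f ord_max.
  rewrite -{1}(qpoly_decomp p) splitRootR_max -!horner_map -!map_poly_comp.
  rewrite (@horner_coef_wide _ 2) ?(leq_trans (size_poly _ _)) //.
  by rewrite big_ord_recl big_ord1 !coef_map mulr1.
have b_roots : splitEmb 2 f b * splitRootR f (lift ord_max ord_max)
             = splitEmb 2 f b * splitRootR f ord_max.
  by move: act_p; rewrite pE rmorphD rmorphM !actC actX tpermL => /addrI.
have -> : splitDR 2%N f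
    = splitRootR f (lift ord_max ord_max) + splitRootR f ord_max.
  rewrite big_ord_recl big_ord1 [X in _ * X]big1 => [|[[|[|]]]] //.
  rewrite mulr1 big_mkcond big_ord_recl big_ord1 [LHS]mul1r.
  by congr (_ + _); congr (splitRootR f _); apply: val_inj.
rewrite mulrDr b_roots -mulrDr -mulr2n mulrnAr -mulrnAl -rmorphMn b2.
by rewrite rmorph0 mul0r.
Qed.

Lemma fixed_qpoly_in_base (n : nat) (A : comNzRingType) (f : {poly A})
    (p : {poly %/ f}) :
    f \is monic -> size f = n.+2 ->
    permFixed (f := f) (splitEmb n (deflate f) p : splitRing n.+1 f) ->
    (forall b : A, b *+ 2 = 0 -> splitEmb n.+1 f b * splitDR n.+1 f = 0 ->
      b = 0) ->
  exists a, p = qpolyC f a.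
Proof.
move=> f_monic f_size p_fixed D_reg; exists p`_0.
case: n f_size p_fixed D_reg => [|m] f_size p_fixed D_reg.
  apply: val_inj; rewrite /= [LHS]size1_polyC // -ltnS -f_size.
  by rewrite size_qpoly ?f_size.
have [pE b2 b_gt0] :=
  fixed_qpolyE f_monic f_size (fixed_qpoly_mod f_monic f_size p_fixed).
apply: pE.
case: m f_size p_fixed D_reg b2 b_gt0 => [|m] f_size p_fixed D_reg b2 b_gt0.
  by apply: D_reg b2 (fixed_quadratic f_monic f_size p_fixed b2).
exact: b_gt0.
Qed.

(** The hypothesis on 2 and D_f passes from A to A[tau_n]: D_f is a multiple of
    the corresponding product over A[tau_n], and since D_f lies in A, an element
    of A[tau_n] killed by D_f has all its coefficients killed by D_f. *)
Lemma fixed_in_base (n : nat) (A : comNzRingType) (f : {poly A}) :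
    f \is monic -> size f = n.+1 ->
    (forall b : A, b *+ 2 = 0 -> splitEmb n f b * splitDR n f = 0 -> b = 0) ->
  forall x : splitRing n f, permFixed x -> exists a, x = splitEmb n f a.
Proof.
elim: n A f => [|n IHn] A f f_monic f_size D_reg x x_fixed; first by exists x.
have f_gt1 : (1 < size f)%N by rewrite f_size.
have [||||p pE] := IHn _ (deflate f) _ _ _ x _.
- exact: deflate_monic.
- by rewrite size_deflate ?f_size.
- move=> b b2 bD; have [d dE] := splitD_in_base f_monic f_size.
  have bd : qpolyC f d * b = 0.
    apply: (@splitEmb_inj n _ (deflate f)); rewrite rmorphM rmorph0 mulrC.
    have /= <- := dE; by rewrite splitD_deflate mulrA bD mul0r.
  apply: val_inj; apply/polyP => k; rewrite coef0; apply: D_reg.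
    by rewrite -coefMn; have /(congr1 (fun q : {poly %/ f} => q`_k)) := b2;
       rewrite coef0.
  rewrite dE -rmorphM mulrC -coef_qpolyCM bd coef0; exact: rmorph0.
- move=> s h hC hX; apply: (x_fixed (lift_perm ord_max ord_max s) h) => [a|i].
    exact: hC.
  case: (unliftP ord_max i) => [j|] ->.
    by rewrite lift_perm_lift !splitRootR_lift.
  by rewrite lift_perm_id splitRootR_max hC.
have [|a pa] := @fixed_qpoly_in_base n A f p f_monic f_size _ D_reg.
  by rewrite -pE.
by exists a; rewrite pE pa.
Qed.

(** * Bases and base change *)

Lemma qpoly_sumE (n : nat) (A : comNzRingType) (f : {poly A}) (a : 'I_n.+1 -> A) :
    f \is monic -> size f = n.+2 ->
  (\sum_k qpolyC f (a k) * 'qX ^+ k : {poly %/ f})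
  = \sum_k a k *: 'X^k :> {poly A}.
Proof.
move=> f_monic f_size.
have -> : \sum_k qpolyC f (a k) * 'qX ^+ k = in_qpoly f (\sum_k a k *: 'X^k).
  rewrite -horner_qpolyX raddf_sum horner_sum; apply: eq_bigr => k _.
  by rewrite /= map_polyZ map_polyXn hornerZ hornerXn.
rewrite in_qpoly_small // mk_monicE ?f_size // ltnS.
apply: leq_trans (size_sum _ _ _) _; apply/bigmax_leqP => k _.
by rewrite (leq_trans (size_scale_leq _ _)) // size_polyXn.
Qed.

Definition rootMonomial (n : nat) (A : comNzRingType) (f : {poly A})
    (m : 'I_n -> nat) : splitRing n f :=
  \prod_k splitRootR f k ^+ m k.

Definition extend_exponent (n : nat) (m : 'I_n -> nat) (e : nat) (j : 'I_n.+1) :=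
  if unlift ord_max j is Some j' then m j' else e.

Lemma rootMonomialS (n : nat) (A : comNzRingType) (f : {poly A}) m e :
  rootMonomial (n := n.+1) f (extend_exponent m e)
  = rootMonomial (n := n) (deflate f) m * splitEmb n (deflate f) ('qX ^+ e).
Proof.
rewrite {1}/rootMonomial big_ord_recr; congr (_ * _); last first.
  by rewrite /extend_exponent unlift_none splitRootR_max rmorphXn.
apply: eq_bigr => j _; rewrite widen_ord_lift.
by rewrite /extend_exponent liftK splitRootR_lift.
Qed.

Lemma splitRing_basis (n : nat) (A : comNzRingType) (f : {poly A}) :
    f \is monic -> size f = n.+1 ->
  exists (I : finType) (m : I -> 'I_n -> nat),
    (forall x, exists a, x = \sum_i splitEmb n f (a i) * rootMonomial f (m i)) /\
    (forall a, \sum_i splitEmb n f (a i) * rootMonomial f (m i) = 0 ->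
       forall i, a i = 0).
Proof.
elim: n A f => [|n IHn] A f f_monic f_size.
  exists unit, (fun _ _ => 0%N); split=> [x | a].
    exists (fun=> x); rewrite (bigD1 tt) //= big1 => [|[]//].
    by rewrite addr0 /rootMonomial big_ord0 mulr1.
  rewrite (bigD1 tt) //= big1 => [|[]//].
  by rewrite addr0 /rootMonomial big_ord0 mulr1 => a0 [].
have f_gt1 : (1 < size f)%N by rewrite f_size.
have [||I [m [span indep]]] := IHn _ (deflate f).
- exact: deflate_monic.
- by rewrite size_deflate ?f_size.
exists (I * 'I_n.+1)%type, (fun ik : I * 'I_n.+1 => extend_exponent (m ik.1) ik.2).
have sumE (a : I * 'I_n.+1 -> A) :
    \sum_ik splitEmb n.+1 f (a ik)
        * rootMonomial f (extend_exponent (m ik.1) ik.2)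
    = \sum_i splitEmb n (deflate f) (\sum_k qpolyC f (a (i, k)) * 'qX ^+ k)
        * rootMonomial (deflate f) (m i).
  transitivity (\sum_i \sum_(k < n.+1) splitEmb n.+1 f (a (i, k))
      * rootMonomial f (extend_exponent (m i) k)).
    by rewrite pair_bigA; apply: eq_bigr => -[].
  apply: eq_bigr => i _; rewrite rmorph_sum mulr_suml; apply: eq_bigr => k _.
  by rewrite rootMonomialS rmorphM mulrA mulrAC.
split=> [x | a].
  have [p ->] := span x.
  exists (fun ik : I * 'I_n.+1 => (p ik.1)`_ik.2); rewrite sumE.
  apply: eq_bigr => i _.
  congr (splitEmb n _ _ * _); apply: val_inj.
  rewrite [RHS]qpoly_sumE // -(poly_def n.+1 (fun k => (p i)`_k)).
  apply/polyP => k; rewrite coef_poly; case: ltnP => // le_nk.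
  rewrite nth_default // (leq_trans _ le_nk) // -ltnS -f_size.
  exact: size_qpoly.
rewrite sumE => /indep a0 [i k].
have /(congr1 (fun q : {poly %/ f} => q`_k)) := a0 i.
rewrite qpoly_sumE // coef_sum (bigD1 k) // big1 => [|l ne_lk].
  by rewrite /= coefZ coefXn eqxx mulr1 addr0 coef0.
by rewrite coefZ coefXn eq_sym val_eqE (negPf ne_lk) mulr0.
Qed.

Section BaseChange.
Variables (n : nat) (A : comNzRingType) (f : {poly A}).
Hypotheses (f_monic : f \is monic) (f_size : size f = n.+1).
Let C := splitRing n f.
Let fC : {poly C} := map_poly (splitEmb n f) f.
Let W := splitRing n fC.
Let eC : {rmorphism A -> C} := splitEmb n f.
Let eW : {rmorphism C -> W} := splitEmb n fC.
Let tau : 'I_n -> C := splitRootR f.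
Let rho : 'I_n -> W := splitRootR fC.

Let fC_monic : fC \is monic. Proof. by rewrite monic_map. Qed.
Let fC_size : size fC = n.+1.
Proof.
by rewrite size_map_poly_id0 // (monicP f_monic) rmorph1 oner_neq0.
Qed.

Let prod_tau : fC = \prod_i ('X - (tau i)%:P).
Proof. exact: splitRingP. Qed.

Let prod_rho : map_poly eW fC = \prod_i ('X - (rho i)%:P).
Proof. exact: splitRingP. Qed.

Lemma prod_rho_tau :
  \prod_i ('X - (rho i)%:P) = \prod_i ('X - (eW (tau i))%:P).
Proof.
rewrite -prod_rho prod_tau rmorph_prod; apply: eq_bigr => i _.
by rewrite rmorphB /= map_polyX map_polyC.
Qed.

(** W is A_f tensored with itself over A; theta exchanges the two factors.
    It turns the action of S_n on the new roots rho into an action on the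
    coefficients y_i of theta w in the basis of monomials in rho, so these
    coefficients are invariant in A_f. *)
Lemma fixed_base_change :
    (forall x : C, permFixed x -> exists a, x = eC a) ->
  forall w : W, permFixed w -> exists c, w = eW c.
Proof.
move=> fixedC w w_fixed.
have map_fC (B : comNzRingType) (phi : {rmorphism C -> B}) :
  map_poly phi fC = map_poly (phi \o eC) f by rewrite map_poly_comp.
have [j jC jX] : {j : {rmorphism C -> W} |
    (forall a, j (eC a) = eW (eC a)) & (forall i, j (tau i) = rho i)}.
  apply: (@splitRing_lift n A W f (eW \o eC)) => //.
  by rewrite -prod_rho map_fC.
have [theta thetaC thetaX] : {theta : {rmorphism W -> W} |
    (forall c, theta (eW c) = j c) & (forall i, theta (rho i) = eW (tau i))}.
  apply: splitRing_lift => //; rewrite -prod_rho_tau -prod_rho !map_fC.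
  by apply: eq_map_poly => a; apply: jC.
(* theta o theta = id, as it fixes the tau_i and the rho_i. *)
have theta_j c : theta (j c) = eW c.
  apply: (@splitRing_uniq n A W f (theta \o j) eW) => [a|i] /=.
    by rewrite [j _]jC thetaC jC.
  by rewrite [j _]jX thetaX.
have thetaK x : theta (theta x) = x.
  apply: (@splitRing_uniq n C W fC (theta \o theta) idfun) => [c|i] /=.
    by rewrite [theta (splitEmb _ _ _)]thetaC theta_j.
  by rewrite [theta (splitRootR _ _)]thetaX thetaC jX.
have [I [m [span indep]]] := splitRing_basis fC_monic fC_size.
have [y thetaw] := span (theta w).
have y_fixed i : permFixed (y i).
  move=> s h hC hX.
  have [psi psiC psiX] : {psi : {rmorphism W -> W} |
      (forall c, psi (eW c) = eW (h c)) & (forall i, psi (rho i) = rho i)}.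
    apply: (@splitRing_lift n C W fC (eW \o h)) => //.
    rewrite -prod_rho !map_fC; apply: eq_map_poly => a /=.
    by rewrite [h _]hC.
  have [hW hWC hWX] := splitRing_perm s fC_monic fC_size.
  have psi_j c : psi (j c) = j c.
    apply: (@splitRing_uniq n A W f (psi \o j) j) => [a|k] /=.
      by rewrite [j _]jC psiC [h _]hC.
    by rewrite [j _]jX psiX.
  have psi_theta x : psi (theta x) = theta (hW x).
    apply: (@splitRing_uniq n C W fC (psi \o theta) (theta \o hW)) => [c|k] /=.
      by rewrite hWC [theta _]thetaC psi_j.
    by rewrite hWX ![theta _]thetaX psiC [h _]hX.
  have psi_w : psi (theta w) = theta w.
    by rewrite psi_theta (w_fixed s hW hWC hWX).
  apply/eqP; rewrite -subr_eq0; apply/eqP.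
  apply: (indep (fun i => h (y i) - y i)).
  rewrite (eq_bigr (fun i => psi (eW (y i) * rootMonomial fC (m i))
    - eW (y i) * rootMonomial fC (m i))) => [|k _].
    by rewrite sumrB -rmorph_sum -thetaw psi_w subrr.
  rewrite rmorphB mulrBl rmorphM psiC; congr (_ * _ - _).
  rewrite rmorph_prod; apply: eq_bigr => l _.
  by rewrite rmorphXn [psi _]psiX.
have [a yE] := fin_all_exists (fun i => fixedC _ (y_fixed i)).
exists (\sum_i eC (a i) * rootMonomial f (m i)).
rewrite -[w]thetaK thetaw !rmorph_sum; apply: eq_bigr => i _.
rewrite !rmorphM thetaC yE jC; congr (_ * _).
rewrite !rmorph_prod; apply: eq_bigr => k _.
by rewrite !rmorphXn [theta _]thetaX.
Qed.
End BaseChange.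

(** * Staircase products *)

Section Staircase.
Variable R : comNzRingType.
Implicit Types (c x : R) (t y : nat -> R).

Definition monicRoots n y : {poly R} := \prod_(i < n) ('X - (y i)%:P).

Definition rootsProd n y x : R := \prod_(j < n) (x - y j).

(** The double Schubert polynomial of the longest permutation. *)
Definition staircase n t y : R := \prod_(i < n) rootsProd i y (t i).

Lemma horner_monicRoots n y x : (monicRoots n y).[x] = rootsProd n y x.
Proof. by rewrite horner_prod; apply: eq_bigr => i _; rewrite hornerXsubC. Qed.

Lemma rootsProdS n y x : rootsProd n.+1 y x = rootsProd n y x * (x - y n).
Proof. exact: big_ord_recr. Qed.

Lemma monicRootsS n y : monicRoots n.+1 y = monicRoots n y * ('X - (y n)%:P).
Proof. exact: big_ord_recr. Qed.

Lemma staircaseS n t y :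
  staircase n.+1 t y = staircase n t y * rootsProd n y (t n).
Proof. exact: big_ord_recr. Qed.

Lemma mulXsubC_inj x : injective (fun p : {poly R} => p * ('X - x%:P)).
Proof. exact/monic_rreg/monicXsubC. Qed.

Lemma last_root n c t y :
    c *: monicRoots n.+1 t = c *: monicRoots n.+1 y ->
  c * rootsProd n y (t n) * (t n - y n) = 0.
Proof.
move/(congr1 (fun p : {poly R} => p.[t n])).
by rewrite !hornerZ !horner_monicRoots !rootsProdS subrr !mulr0 mulrA => <-.
Qed.

(** The factor [rootsProd n y (t n)] makes t_n and y_n interchangeable, after
    which the factor t - t_n can be cancelled on both sides. *)
Lemma drop_last_root n c t y :
    c *: monicRoots n.+1 t = c *: monicRoots n.+1 y ->
  (c * rootsProd n y (t n)) *: monicRoots n t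
  = (c * rootsProd n y (t n)) *: monicRoots n y.
Proof.
move=> ty; have := last_root ty; set u := rootsProd n y (t n) => cu.
apply: (@mulXsubC_inj (t n)); rewrite -!scalerAl -monicRootsS.
rewrite mulrC -scalerA ty monicRootsS scalerA mulrC.
have -> : 'X - (y n)%:P = 'X - (t n)%:P + (t n - y n)%:P.
  by rewrite rmorphB addrA subrK.
by rewrite mulrDr scalerDr [_ * _%:P]mulrC mul_polyC scalerA cu scale0r addr0.
Qed.

(** The last factor of the product lets t_n act as y_n, and dropping the last
    root gives the same for the others: the staircase product is, up to c, a
    common eigenvector for the multiplications by the t_k. *)
Lemma staircase_root n c t y k :
    c *: monicRoots n t = c *: monicRoots n y -> (k < n)%N ->
  c * staircase n t y * (t k - y k) = 0.
Proof.
elim: n c => // n IHn c ty; rewrite ltnS leq_eqVlt staircaseS.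
rewrite [staircase _ _ _ * _]mulrC mulrA => /orP [/eqP -> | lt_kn].
  by rewrite mulrAC last_root // mul0r.
exact: IHn (drop_last_root ty) lt_kn.
Qed.

Definition swapS (k i : nat) : nat :=
  if i == k then k.+1 else if i == k.+1 then k else i.

Lemma swapSL k : swapS k k = k.+1. Proof. by rewrite /swapS eqxx. Qed.
Lemma swapSR k : swapS k k.+1 = k.
Proof. by rewrite /swapS eqxx (gtn_eqF (ltnSn k)). Qed.
Lemma swapS_lt k i : (i < k)%N -> swapS k i = i.
Proof. by move=> lt_ik; rewrite /swapS !ltn_eqF // ltnW. Qed.
Lemma swapS_gt k i : (k.+1 < i)%N -> swapS k i = i.
Proof. by move=> lt_ki; rewrite /swapS !gtn_eqF // ltnW. Qed.

Lemma rootsProd_swap n k y x : (k.+1 < n)%N ->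
  rootsProd n (y \o swapS k) x = rootsProd n y x.
Proof.
elim: n => // n IHn; rewrite ltnS leq_eqVlt rootsProdS => /orP [/eqP <-|lt_kn].
  rewrite !rootsProdS /= swapSL swapSR mulrAC; congr (_ * _ * _).
  by apply: eq_bigr => i _; rewrite /= swapS_lt.
by rewrite IHn // rootsProdS /= swapS_gt.
Qed.

(** Modulo annihilators, Q(x) = (x - y_n) (x - y_(n+1)) has the root t_(n+1),
    and its other root is y_n + y_(n+1) - t_(n+1); this one must be t_n once the
    factors vanishing at y_0, ..., y_(n-1) have been inverted. *)
Lemma staircase_swap_last n c t y :
    c *: monicRoots n.+2 t = c *: monicRoots n.+2 y ->
  c * (rootsProd n y (t n) * rootsProd n y (t n.+1)
       * (t n + t n.+1 - y n - y n.+1)) = 0.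
Proof.
move=> ty; have := last_root ty; rewrite rootsProdS.
set u := rootsProd n y (t n.+1) => cu.
have : (c * u) *: monicRoots n.+1 t
    = (c * u) *: (monicRoots n y * ('X - (y n + y n.+1 - t n.+1)%:P)).
  apply: (@mulXsubC_inj (t n.+1)); rewrite -!scalerAl -monicRootsS.
  rewrite mulrC -scalerA ty scalerA mulrC !monicRootsS -!mulrA.
  have -> : ('X - (y n)%:P) * ('X - (y n.+1)%:P)
      = ('X - (y n + y n.+1 - t n.+1)%:P) * ('X - (t n.+1)%:P)
        + ((t n.+1 - y n) * (t n.+1 - y n.+1))%:P.
    by rewrite !(rmorphB, rmorphD, rmorphM) /=; ring.
  rewrite mulrDr scalerDr [_ * _%:P]mulrC mul_polyC scalerA !mulrA.
  by rewrite -[c * u * _]mulrA in cu *; rewrite cu scale0r addr0.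
move/(congr1 (fun p : {poly R} => p.[t n])).
rewrite !hornerZ hornerM !horner_monicRoots rootsProdS subrr !mulr0 hornerXsubC.
move=> /esym E0; rewrite -[RHS]E0; ring.
Qed.

(** Only adjacent indices are exchanged, so that the product changes in a
    single factor, from t_(k+1) - y_k to t_k - y_k or t_(k+1) - y_(k+1); the sum
    of these two is the last factor in [staircase_swap_last]. *)
Lemma staircase_swap n k c t y : (k.+1 < n)%N ->
    c *: monicRoots n t = c *: monicRoots n y ->
  c * (staircase n (t \o swapS k) y + staircase n t (y \o swapS k)) = 0.
Proof.
elim: n c => // n IHn c; rewrite ltnS leq_eqVlt => /orP [/eqP <-|lt_kn] ty.
  have loc (s : nat -> R) z i : (i <= k)%N ->
      rootsProd i (z \o swapS k) (s i) = rootsProd i z (s i).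
    move=> le_ik; apply: eq_bigr => j _.
    by rewrite /= swapS_lt // (leq_trans (ltn_ord j)).
  have tE : staircase k (t \o swapS k) y = staircase k t y.
    by apply: eq_bigr => i _; rewrite /= swapS_lt.
  have yE : staircase k t (y \o swapS k) = staircase k t y.
    by apply: eq_bigr => i _; rewrite loc // ltnW.
  rewrite !staircaseS !rootsProdS /= tE yE !swapSL !swapSR !loc //.
  have -> : rootsProd k (y \o swapS k) (t k.+1) = rootsProd k y (t k.+1).
    exact: (loc (fun=> t k.+1)).
  have E0 := staircase_swap_last ty.
  transitivity (staircase k t y * (c * (rootsProd k y (t k)
      * rootsProd k y (t k.+1) * (t k + t k.+1 - y k - y k.+1)))).
    by ring.
  by rewrite E0 mulr0.
rewrite !staircaseS rootsProd_swap // /= swapS_gt // -mulrDl.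
by rewrite [_ * rootsProd _ _ _]mulrC mulrA IHn // drop_last_root.
Qed.

End Staircase.

(** * The top coefficient *)

(** The coefficient of the product of the tau_i^(i-1), the monomial of highest
    degree in the basis of A_f over A. *)
Fixpoint splitTop (n : nat) (A : comNzRingType) (f : {poly A}) :
    splitRing n f -> A :=
  match n return splitRing n f -> A with
  | 0 => id
  | m.+1 => fun x => (@splitTop m {poly %/ f} (deflate f) x)`_m
  end.

Lemma splitTopS (n : nat) (A : comNzRingType) (f : {poly A})
    (x : splitRing n.+1 f) :
  splitTop x = (splitTop (f := deflate f) x)`_n.
Proof. by []. Qed.

Lemma splitTopZ (n : nat) (A : comNzRingType) (f : {poly A}) a x :
  splitTop (f := f) (splitEmb n f a * x) = a * splitTop (f := f) x.
Proof.
elim: n A f a x => // n IHn A f a x.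
rewrite -coef_qpolyCM; congr (polyseq (polyn _))`_n.
exact: (IHn {poly %/ f} (deflate f) (qpolyC f a) x).
Qed.

Definition evalRoots (n : nat) (A : comNzRingType) (f : {poly A})
    (p : 'I_n -> {poly A}) : splitRing n f :=
  \prod_i (map_poly (splitEmb n f) (p i)).[splitRootR f i].

Lemma evalRootsS (n : nat) (A : comNzRingType) (f : {poly A})
    (p : 'I_n.+1 -> {poly A}) :
  evalRoots (n := n.+1) f p = splitEmb n (deflate f) (in_qpoly f (p ord_max))
    * evalRoots (n := n) (deflate f)
        (fun i => map_poly (qpolyC f) (p (lift ord_max i))).
Proof.
rewrite {1}/evalRoots big_ord_recr /= unlift_none mulrC; congr (_ * _).
  exact: horner_in_qpoly.
apply: eq_bigr => i _; rewrite widen_ord_lift.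
by rewrite liftK -map_poly_comp.
Qed.

Lemma splitTop_monic (n : nat) (A : comNzRingType) (f : {poly A})
    (p : 'I_n -> {poly A}) :
    f \is monic -> size f = n.+1 ->
    (forall i, p i \is monic) -> (forall i, size (p i) = i.+1) ->
  splitTop (evalRoots f p) = 1.
Proof.
elim: n A f p => [|n IHn] A f p f_monic f_size p_monic p_size.
  by rewrite /evalRoots big_ord0.
have f_gt1 : (1 < size f)%N by rewrite f_size.
rewrite evalRootsS splitTopS splitTopZ IHn.
- rewrite mulr1 in_qpoly_small; last by rewrite mk_monicE // p_size f_size.
  by have /monicP := p_monic ord_max; rewrite lead_coefE p_size.
- exact: deflate_monic.
- by rewrite size_deflate ?f_size.
- by move=> i; rewrite monic_map.
move=> i; rewrite size_map_poly_id0; last first.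
  by rewrite (monicP (p_monic _)) rmorph1 oner_neq0.
by rewrite p_size lift_max.
Qed.

(** A product that does not involve tau_1 and tau_2 lies in A_2, over which
    A_f has the basis 1, tau_2. *)
Lemma splitTop_low (n : nat) (A : comNzRingType) (f : {poly A})
    (p : 'I_n.+2 -> {poly A}) :
    f \is monic -> size f = n.+3 -> (forall i : 'I_n.+2, (i < 2)%N -> p i = 1) ->
  splitTop (evalRoots f p) = 0.
Proof.
elim: n A f p => [|n IHn] A f p f_monic f_size p1.
  rewrite evalRootsS p1 // rmorph1 rmorph1 mul1r splitTopS.
  rewrite evalRootsS p1 // !rmorph1 mul1r splitTopS /evalRoots big_ord0.
  by rewrite /= !coefC.
have f_gt1 : (1 < size f)%N by rewrite f_size.
rewrite evalRootsS splitTopS splitTopZ IHn.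
- by rewrite mulr0 coef0.
- exact: deflate_monic.
- by rewrite size_deflate ?f_size.
by move=> i lt_i2; rewrite p1 ?rmorph1 // lift_max.
Qed.

(** * Auxiliary facts on products, permutations and congruences *)

(** Take for c * b the last nonzero partial product. *)
Lemma annihilated_factor (R : comNzRingType) (I : finType) (P : pred I)
    (F : I -> R) (c : R) :
    c != 0 -> c * \prod_(i | P i) F i = 0 ->
  exists b i, [/\ P i, c * b != 0 & c * b * F i = 0].
Proof.
rewrite -big_filter; have /allP Ps : all P [seq i <- index_enum I | P i].
  exact: filter_all.
elim: [seq i <- _ | _] c Ps => [|i s IHs] c Ps c_neq0.
  by rewrite big_nil mulr1 => c0; rewrite c0 eqxx in c_neq0.
rewrite big_cons mulrA => cFs.
have [cF0 | cF_neq0] := eqVneq (c * F i) 0.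
  by exists 1, i; rewrite mulr1; split=> //; apply: Ps; rewrite mem_head.
have Ps' : {in s, forall k, P k}.
  by move=> k ks; apply: Ps; rewrite inE ks orbT.
have [b [j [Pj cb cbF]]] := IHs _ Ps' cF_neq0 cFs.
by exists (F i * b), j; rewrite mulrA.
Qed.

Lemma adjacent_tperm_ind (n : nat) (P : 'S_n.+1 -> Prop) :
    P 1%g -> (forall s t, P s -> P t -> P (s * t)%g) ->
    (forall k, (k < n)%N -> P (tperm (inord k) (inord k.+1))) ->
  forall s, P s.
Proof.
move=> P1 PM Padj.
have Plt d i : (i + d < n)%N -> P (tperm (inord i) (inord (i + d).+1)).
  elim: d => [|d IHd] lt_n; first by rewrite addn0 in lt_n *; apply: Padj.
  rewrite addnS in lt_n *; set j := (i + d).+1.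
  have lt_ij : (i < j)%N by rewrite ltnS leq_addr.
  have iK : (inord i : 'I_n.+1) = i :> nat.
    by rewrite inordK // ltnS ltnW // (ltn_trans lt_ij).
  have jK : (inord j : 'I_n.+1) = j :> nat by rewrite inordK // ltnS ltnW.
  have jSK : (inord j.+1 : 'I_n.+1) = j.+1 :> nat by rewrite inordK.
  have -> : tperm (inord i : 'I_n.+1) (inord j.+1)
      = (tperm (inord i) (inord j) ^ tperm (inord j) (inord j.+1))%g.
    by rewrite tpermJ tpermL tpermD // -val_eqE /= ?jSK ?jK iK gtn_eqF // leqW.
  rewrite /conjg tpermV; apply: PM (Padj j lt_n) (PM _ _ _ (Padj j lt_n)).
  exact: IHd (ltnW lt_n).
have Pt x y : P (tperm x y).
  wlog le_xy : x y / (x <= y)%N => [Pt|].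
    by have [/Pt|/ltnW/Pt] := leqP x y => //; rewrite tpermC.
  move: le_xy; rewrite leq_eqVlt => /orP [/eqP/val_inj -> | lt_xy].
    by rewrite tperm1.
  have dE : (x + (y - x.+1)).+1%N = y :> nat by rewrite -addSn subnKC.
  by have := Plt (y - x.+1)%N x; rewrite dE !inord_val -ltnS; apply.
move=> s; have [ts -> _] := prod_tpermP s.
by apply: (big_ind P) => // t _; apply: Pt.
Qed.

Lemma eq_staircase (R : comNzRingType) n (t t' y y' : nat -> R) :
    (forall i, (i < n)%N -> t i = t' i) -> (forall i, (i < n)%N -> y i = y' i) ->
  staircase n t y = staircase n t' y'.
Proof.
move=> tE yE; apply: eq_bigr => i _; rewrite tE //; apply: eq_bigr => j _.
by rewrite yE // (ltn_trans (ltn_ord j)).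
Qed.

Lemma rmorph_staircase (R S : comNzRingType) (h : {rmorphism R -> S}) n t y :
  h (staircase n t y) = staircase n (h \o t) (h \o y).
Proof.
rewrite rmorph_prod; apply: eq_bigr => i _; rewrite rmorph_prod.
by apply: eq_bigr => j _; rewrite rmorphB.
Qed.

Lemma mul_horner_congr (R : comNzRingType) (a x y : R) (q : {poly R}) :
  a * x = a * y -> a * q.[x] = a * q.[y].
Proof.
move=> axy; elim/poly_ind: q => [|q d IHq]; first by rewrite !horner0.
rewrite !hornerMXaddC !mulrDr; congr (_ + _).
by rewrite mulrA IHq mulrAC axy mulrAC mulrA.
Qed.

Lemma mul_prod_congr (R : comNzRingType) (I : finType) (a : R) (F G : I -> R) :
  (forall i, a * F i = a * G i) -> a * \prod_i F i = a * \prod_i G i.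
Proof.
move=> aFG; elim/big_rec2: _ => // i x y _ axy.
by rewrite mulrA aFG mulrAC axy mulrAC mulrA.
Qed.

Lemma permFixed_adjacent (n : nat) (A : comNzRingType) (f : {poly A})
    (w : splitRing n.+1 f) :
    f \is monic -> size f = n.+2 ->
    (forall k (h : {rmorphism splitRing n.+1 f -> splitRing n.+1 f}),
      (k < n)%N -> (forall a, h (splitEmb n.+1 f a) = splitEmb n.+1 f a) ->
      (forall i, h (splitRootR f i)
         = splitRootR f (tperm (inord k) (inord k.+1) i)) -> h w = w) ->
  permFixed w.
Proof.
move=> f_monic f_size w_adj; rewrite /permFixed.
apply: adjacent_tperm_ind => [h hC hX | s t sP tP h hC hX | k lt_kn h hC hX].
- apply: (@splitRing_uniq n.+1 A _ f h idfun) => [a|i]; first exact: hC.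
  by rewrite hX perm1.
- have [hs hsC hsX] := splitRing_perm s f_monic f_size.
  have [ht htC htX] := splitRing_perm t f_monic f_size.
  rewrite -[RHS](tP ht htC htX) -[in RHS](sP hs hsC hsX).
  apply: (@splitRing_uniq n.+1 A _ f h (ht \o hs)) => [a|i].
    by rewrite hC [RHS]/= [in RHS]hsC htC.
  by rewrite hX permM [RHS]/= [in RHS]hsX htX.
exact: (w_adj k).
Qed.

(** * The sum of staircase products over the orderings of the roots *)

Lemma eq_of_add_char2 (R : comNzRingType) (c a b : R) :
  c *+ 2 = 0 -> c * (a + b) = 0 -> c * a = c * b.
Proof.
rewrite mulrDr => c2 /eqP; rewrite addr_eq0 => /eqP ->.
by apply/eqP; rewrite eq_sym -addr_eq0 -mulr2n -mulrnAl c2 mul0r.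
Qed.

Lemma size_prod_XsubC_ord (R : comNzRingType) n (y : 'I_n -> R) :
  size (\prod_i ('X - (y i)%:P)) = n.+1.
Proof.
have -> : \prod_i ('X - (y i)%:P) = \prod_(i <- enum 'I_n) ('X - (y i)%:P).
  by rewrite big_enum.
by rewrite size_prod_XsubC size_enum_ord.
Qed.

(** The map r selects a representative among indices whose roots t_i agree up to
    multiplication by c.  Distinct s may give the same function r o s; the sum
    below has one term per function, as the number of s for each of them may
    be even and c is killed by 2. *)
Section Orbit.
Variables (m : nat) (C : comNzRingType) (t : 'I_m.+1 -> C).
Let n := m.+1.
Let g : {poly C} := \prod_i ('X - (t i)%:P).
Let W := splitRing n g.
Let eW : {rmorphism C -> W} := splitEmb n g.
Let rho : 'I_n -> W := splitRootR g.
Variables (c : C) (r : 'I_n -> 'I_n).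
Hypotheses (c2 : c *+ 2 = 0) (c_r : forall i, c * t (r i) = c * t i).

Lemma prodXsubC_monic : g \is monic.
Proof. exact: monic_prod_XsubC. Qed.

Lemma size_prodXsubC : size g = n.+1.
Proof. exact: size_prod_XsubC_ord. Qed.

Definition orbit_of : {set {ffun 'I_n -> 'I_n}} :=
  [set [ffun i => r ((s : 'S_n) i)] | s in [set: 'S_n]].

Lemma orbit_perm (s : 'S_n) (mu : {ffun 'I_n -> 'I_n}) :
  ([ffun i => mu (s i)] \in orbit_of) = (mu \in orbit_of).
Proof.
have imp (u : 'S_n) (nu : {ffun 'I_n -> 'I_n}) :
    nu \in orbit_of -> [ffun i => nu (u i)] \in orbit_of.
  case/imsetP => v _ ->; apply/imsetP; exists (u * v)%g => //.
  by apply/ffunP => i; rewrite !ffunE permM.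
apply/idP/idP => [mu_orb|]; last exact: imp.
have <- : [ffun i => [ffun j => mu (s j)] (s^-1%g i)] = mu.
  by apply/ffunP => i; rewrite !ffunE permKV.
exact: imp.
Qed.

Lemma scaled_roots (mu : {ffun 'I_n -> 'I_n}) :
  mu \in orbit_of -> c *: \prod_i ('X - (t (mu i))%:P) = c *: g.
Proof.
case/imsetP => s _ ->.
have -> : g = \prod_i ('X - (t (s i))%:P).
  exact: (reindex_inj (@perm_inj _ s)).
rewrite -!mul_polyC; apply: mul_prod_congr => i; rewrite ffunE !mulrBr.
by rewrite -!polyCM c_r.
Qed.

Definition orbitPoint (mu : {ffun 'I_n -> 'I_n}) (k : nat) : C := t (mu (inord k)).
Let rho' k := rho (inord k).

Lemma orbit_roots (mu : {ffun 'I_n -> 'I_n}) : mu \in orbit_of ->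
  eW c *: monicRoots n rho' = eW c *: monicRoots n (eW \o orbitPoint mu).
Proof.
move=> mu_orb; have gE := splitRingP prodXsubC_monic size_prodXsubC.
have -> : monicRoots n rho' = map_poly eW g.
  by rewrite gE; apply: eq_bigr => i _; rewrite /rho' inord_val.
rewrite -map_polyZ -(scaled_roots mu_orb) map_polyZ rmorph_prod.
congr (_ *: _); apply: eq_bigr => i _.
by rewrite rmorphB /= map_polyX map_polyC /= /orbitPoint inord_val.
Qed.

Definition orbitSum : W :=
  \sum_(mu in orbit_of) staircase n rho' (eW \o orbitPoint mu).

(** An exchange of adjacent roots rho changes the sign of a staircase product
    and permutes the orderings; signs do not matter because 2 c = 0. *)
Lemma orbitSum_fixed : permFixed (eW c * orbitSum).
Proof.
apply: permFixed_adjacent prodXsubC_monic size_prodXsubC _ => k h lt_km hC hX.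
have swapE i : (i < n)%N ->
    tperm (inord k) (inord k.+1) (inord i : 'I_n) = inord (swapS k i).
  move=> lt_in; have inordE a b : (a < n)%N -> (b < n)%N ->
      ((inord a : 'I_n) == inord b) = (a == b).
    by move=> lt_an lt_bn; rewrite -val_eqE /= !inordK.
  have lt_kn : (k < n)%N by apply: ltnW.
  rewrite /swapS; case: eqVneq => [->|ne_ik]; first by rewrite tpermL.
  case: eqVneq => [->|ne_ik1]; first by rewrite tpermR.
  by rewrite tpermD // inordE // eq_sym.
pose s : 'S_n := tperm (inord k) (inord k.+1).
have step mu : mu \in orbit_of -> eW c * h (staircase n rho' (eW \o orbitPoint mu))
    = eW c * staircase n rho' (eW \o orbitPoint [ffun i => mu (s i)]).
  move=> mu_orb.
  have -> : h (staircase n rho' (eW \o orbitPoint mu))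
      = staircase n (rho' \o swapS k) (eW \o orbitPoint mu).
    rewrite rmorph_staircase; apply: eq_staircase => i lt_in; last exact: hC.
    by rewrite -[LHS]/(h (rho (inord i))) [LHS]hX swapE.
  have -> : staircase n rho' (eW \o orbitPoint [ffun i => mu (s i)])
      = staircase n rho' ((eW \o orbitPoint mu) \o swapS k).
    apply: eq_staircase => // i lt_in.
    rewrite -[LHS]/(eW (t ([ffun i => mu (s i)] (inord i)))).
    by rewrite ffunE swapE.
  have c2W : eW c *+ 2 = 0 by rewrite -rmorphMn c2 rmorph0.
  have lt_kn : (k.+1 < n)%N by rewrite ltnS.
  exact: eq_of_add_char2 c2W (staircase_swap lt_kn (orbit_roots mu_orb)).
rewrite rmorphM hC /orbitSum rmorph_sum !mulr_sumr (eq_bigr _ step).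
pose act (mu : {ffun 'I_n -> 'I_n}) := [ffun i => mu (s i)].
have actK : involutive act by move=> mu; apply/ffunP => i; rewrite !ffunE tpermK.
rewrite [RHS](reindex_inj (inv_inj actK)); apply: eq_bigl => mu.
by rewrite orbit_perm.
Qed.

Lemma orbit_eval (mu : {ffun 'I_n -> 'I_n}) (p : 'I_n -> {poly C}) :
    mu \in orbit_of ->
  eW c * staircase n rho' (eW \o orbitPoint mu) * evalRoots g p
  = eW (c * \prod_i (p i).[t (mu i)]) * staircase n rho' (eW \o orbitPoint mu).
Proof.
move=> mu_orb; set Z := staircase _ _ _.
have -> : eW (c * \prod_i (p i).[t (mu i)])
    = eW c * \prod_i (map_poly eW (p i)).[eW (t (mu i))].
  rewrite rmorphM rmorph_prod; congr (_ * _); apply: eq_bigr => i _.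
  by rewrite horner_map.
rewrite [RHS]mulrAC; apply: mul_prod_congr => i; apply: mul_horner_congr.
have := staircase_root (orbit_roots mu_orb) (ltn_ord i).
rewrite mulrBr => /eqP; rewrite subr_eq0 => /eqP.
by rewrite /rho' /= /orbitPoint inord_val.
Qed.

Lemma staircase_evalRoots (mu : {ffun 'I_n -> 'I_n}) :
  staircase n rho' (eW \o orbitPoint mu)
  = evalRoots g (fun i => monicRoots i (orbitPoint mu)).
Proof.
apply: eq_bigr => i _; rewrite /rho' inord_val -horner_monicRoots.
congr horner; rewrite rmorph_prod; apply: eq_bigr => j _.
by rewrite rmorphB /= map_polyX map_polyC.
Qed.

Lemma splitTop_staircase (mu : {ffun 'I_n -> 'I_n}) :
  splitTop (staircase n rho' (eW \o orbitPoint mu)) = 1.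
Proof.
rewrite staircase_evalRoots.
apply: splitTop_monic prodXsubC_monic size_prodXsubC _ _ => i.
  exact: monic_prod_XsubC.
exact: size_prod_XsubC_ord.
Qed.

(** If p separates mu0 from the other orderings, multiplying the invariant sum,
    which is an element d of C, by p(rho) isolates one staircase product, of
    top coefficient 1. *)
Lemma orbit_top (mu0 : {ffun 'I_n -> 'I_n}) (p : 'I_n -> {poly C}) :
    (forall w : W, permFixed w -> exists d, w = eW d) -> mu0 \in orbit_of ->
    (forall mu, mu \in orbit_of -> mu != mu0 -> \prod_i (p i).[t (mu i)] = 0) ->
    splitTop (evalRoots g p) = 0 ->
  c * \prod_i (p i).[t (mu0 i)] = 0.
Proof.
move=> fixedW mu0_orb p_mu p_top; have [d sumE] := fixedW _ orbitSum_fixed.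
have : eW d * evalRoots g p
    = eW (c * \prod_i (p i).[t (mu0 i)]) * staircase n rho' (eW \o orbitPoint mu0).
  rewrite -sumE /orbitSum mulr_sumr mulr_suml (bigD1 mu0) //= big1 => [|mu].
    by rewrite addr0; apply: orbit_eval.
  case/andP => mu_orb ne_mu; rewrite -[LHS]/(eW c * _ * _).
  by rewrite (orbit_eval p mu_orb) p_mu // mulr0 rmorph0 mul0r.
move/(congr1 (@splitTop n C g)); rewrite !splitTopZ p_top splitTop_staircase.
by rewrite mulr0 mulr1.
Qed.

End Orbit.

(** * Enlarging the set of identified roots *)

(** The separating product p avoids the two lowest roots: an ordering that
    agrees with mu0 at all other places agrees with it everywhere, since it takes
    each value as often as mu0 does and since mu0 takes one value at both
    lowest places.  Its value at mu0 is a product of differences of roots in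
    different classes. *)
Lemma orbit_step (N : nat) (C : comNzRingType) (t : 'I_N.+2 -> C) (c : C)
    (i0 j0 : 'I_N.+2) :
    (forall w : splitRing N.+2 (\prod_i ('X - (t i)%:P)), permFixed w ->
      exists d, w = splitEmb N.+2 (\prod_i ('X - (t i)%:P)) d) ->
    c *+ 2 = 0 -> c != 0 -> i0 != j0 -> c * (t i0 - t j0) = 0 ->
  exists b i j, [/\ c * b != 0, c * b * (t i - t j) = 0 & c * (t i - t j) != 0].
Proof.
move=> fixedW c2 c_neq0 ne_ij0 c_ij0.
(* The equivalence relation E has the canonical representatives r i. *)
pose E i j := c * t i == c * t j.
pose r i := odflt i [pick j | E i j].
have Er i : E i (r i).
  by rewrite /r; case: pickP => [j //|/(_ i)]; rewrite /E eqxx.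
have c_r i : c * t (r i) = c * t i by apply/esym/eqP/Er.
have r_eq i j : E i j -> r i = r j.
  move/eqP => Eij; rewrite /r.
  have -> : [pick k | E i k] = [pick k | E j k].
    by apply: eq_pick => k; rewrite /E Eij.
  by case: pickP => // /(_ j); rewrite /E eqxx.
have rK i : r (r i) = r i by apply/esym/r_eq/Er.
have rE i j : r i != r j -> c * (t i - t j) != 0.
  by apply: contraNneq => /eqP; rewrite mulrBr subr_eq0 => /r_eq ->.
pose one : 'I_N.+2 := lift ord0 ord0.
(* Reorder so that the two identified roots come lowest. *)
have [s0 s00 s01] : exists2 s : 'S_N.+2, s ord0 = i0 & s one = j0.
  pose j' := tperm ord0 i0 j0.
  have ne_j' : ord0 != j'.
    by rewrite -(inj_eq (@perm_inj _ (tperm ord0 i0))) tpermL tpermK.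
  exists (tperm one j' * tperm ord0 i0)%g; rewrite permM.
    have -> : tperm one j' ord0 = ord0 by rewrite tpermD // eq_sym.
    by rewrite tpermL.
  by rewrite tpermL tpermK.
pose mu0 : {ffun 'I_N.+2 -> 'I_N.+2} := [ffun i => r (s0 i)].
have mu0_orb : mu0 \in orbit_of r by apply/imsetP; exists s0.
have mu0_one : mu0 one = mu0 ord0.
  rewrite !ffunE s00 s01; apply/esym/r_eq.
  by rewrite /E -subr_eq0 -mulrBr c_ij0.
have count_mu mu k : mu \in orbit_of r ->
    (\sum_i (mu i == k) = \sum_i (r i == k))%N.
  case/imsetP => s _ ->; rewrite [RHS](reindex_inj (@perm_inj _ s)).
  by apply: eq_bigr => i _; rewrite ffunE.
pose low (i : 'I_N.+2) := (i < 2)%N.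
have agree mu : mu \in orbit_of r -> (forall i, ~~ low i -> mu i = mu0 i) ->
    mu = mu0.
  move=> mu_orb mu_high; have := count_mu mu (mu0 ord0) mu_orb.
  rewrite -(count_mu mu0 (mu0 ord0) mu0_orb) !big_ord_recl -/one mu0_one eqxx.
  have -> : (\sum_(i < N) (mu (lift ord0 (lift ord0 i)) == mu0 ord0)
      = \sum_(i < N) (mu0 (lift ord0 (lift ord0 i)) == mu0 ord0))%N.
    by apply: eq_bigr => i _; rewrite mu_high.
  rewrite !addnA => /addIn mu01.
  have /andP [/eqP mu_0 /eqP mu_1] : (mu ord0 == mu0 ord0) && (mu one == mu0 ord0).
    by move: mu01; do 2!case: (_ == _).
  apply/ffunP => i; have [lt_i2|] := boolP (low i); last exact: mu_high.
  case: (unliftP ord0 i) lt_i2 => [j|] -> //.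
  case: (unliftP ord0 j) => [k|] -> //.
  by rewrite -/one mu_1 mu0_one.
pose p i : {poly C} :=
  if low i then 1 else \prod_(k | (r k == k) && (k != mu0 i)) ('X - (t k)%:P).
have p_eval mu i : (p i).[t (mu i)] =
    if low i then 1
    else \prod_(k | (r k == k) && (k != mu0 i)) (t (mu i) - t k).
  rewrite /p; case: ifP => _; first by rewrite hornerC.
  by rewrite horner_prod; apply: eq_bigr => k _; rewrite hornerXsubC.
have cR : c * \prod_i (p i).[t (mu0 i)] = 0.
  apply: (@orbit_top _ _ t c r c2 c_r mu0 p fixedW mu0_orb) => [mu mu_orb ne_mu|].
    have [i hi_i ne_i] : exists2 i, ~~ low i & mu i != mu0 i.
      apply/exists_inP; apply: contraNT ne_mu; rewrite negb_exists_in.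
      move=> /forall_inP mu_eq; apply/eqP/(agree _ mu_orb) => i /mu_eq.
      by rewrite negbK => /eqP.
    rewrite (bigD1 i) //= p_eval (negPf hi_i) (bigD1 (mu i)) /= ?subrr ?mul0r //.
    rewrite ne_i andbT; case/imsetP: mu_orb => s _ ->.
    by rewrite ffunE rK.
  apply: splitTop_low => [||i lt_i2]; last by rewrite /p /low lt_i2.
  - exact: prodXsubC_monic.
  - exact: size_prod_XsubC_ord.
have [b [i [_ cb_neq0]]] := annihilated_factor c_neq0 cR.
rewrite p_eval; case: ifP => [_|_ cbF].
  by rewrite mulr1 => /eqP; rewrite (negPf cb_neq0).
have [b' [k [/andP [/eqP rk ne_k] cbb' cbb'F]]] := annihilated_factor cb_neq0 cbF.
exists (b * b'), (mu0 i), k; rewrite !mulrA; split=> //.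
by apply: rE; rewrite rk ffunE rK eq_sym; move: ne_k; rewrite ffunE.
Qed.

Lemma annihilator_split (N : nat) (C : comNzRingType) (t : 'I_N.+2 -> C) (c : C)
    (i0 j0 : 'I_N.+2) :
    (forall w : splitRing N.+2 (\prod_i ('X - (t i)%:P)), permFixed w ->
      exists d, w = splitEmb N.+2 (\prod_i ('X - (t i)%:P)) d) ->
    c *+ 2 = 0 -> i0 != j0 -> c * (t i0 - t j0) = 0 -> c = 0.
Proof.
move=> fixedW c2 ne_ij0 c_ij0.
(* Induction on the number of differences that do not kill c. *)
pose reg c := [set ij : 'I_N.+2 * 'I_N.+2 | c * (t ij.1 - t ij.2) != 0].
have [k] := ubnP #|reg c|; elim: k c c2 c_ij0 => // k IHk c c2 c_ij0 le_reg.
apply/eqP; apply: contraT => c_neq0.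
have [b [i [j [cb_neq0 cb_ij c_ij]]]] := orbit_step fixedW c2 c_neq0 ne_ij0 c_ij0.
rewrite -(negbTE cb_neq0); apply/eqP; apply: IHk.
- by rewrite -mulrnAl c2 mul0r.
- by rewrite mulrAC c_ij0 mul0r.
rewrite -ltnS; apply: leq_trans le_reg; rewrite ltnS; apply: proper_card.
apply/properP; split.
  apply/subsetP => ij; rewrite !inE; apply: contraNneq => c0.
  by rewrite mulrAC c0 mul0r.
by exists (i, j); rewrite !inE /= ?cb_ij ?eqxx.
Qed.

(** * The criterion *)

Lemma splitAlg_scaleE (n : nat) (A : comNzRingType) (f : {poly A}) a
    (x : splitAlg n f) : a *: x = splitEmb n f a * x :> splitRing n f.
Proof. by []. Qed.

Lemma Ann2E (n : nat) (A : comNzRingType) (f : {poly A}) (a : A) :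
  Ann (2%:R : splitAlg n f) a <-> a *+ 2 = 0.
Proof.
rewrite /Ann splitAlg_scaleE mulr_natr -rmorphMn.
split=> [a2 | ->]; last exact: rmorph0.
by apply: (@splitEmb_inj n A f); rewrite rmorph0.
Qed.

Theorem mainTheorem1 (A : comNzRingType) (n : nat) (f : {poly A})
    (hn : (1 <= n)%N) (f_monic : f \is monic) (f_deg : size f = n.+1) :
  (forall x : splitAlg n f, splitInvariant x <-> exists a : A, x = a%:A) <->
  (forall a : A, Ann (2%:R : splitAlg n f) a /\ Ann (splitD n f) a <-> a = 0).
Proof.
split=> [inv_base a | D_reg x]; last first.
  split=> [/(splitInvariantE _ f_monic f_deg) x_fixed | [a ->] s].
    have [|a xE] := fixed_in_base f_monic f_deg _ x_fixed.
      move=> b b2 bD; apply/D_reg; split; first exact/Ann2E.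
      exact: bD.
    by exists a; rewrite splitAlg_algE.
  have [g gE gX] := splitAct_existence f_monic f_deg s.
  by rewrite -gE rmorph_alg.
split=> [[/Ann2E a2 aD] | ->]; last by split; apply: scale0r.
have fixedC (x : splitRing n f) : permFixed x -> exists b, x = splitEmb n f b.
  move=> /(splitInvariantE _ f_monic f_deg) /inv_base [b ->].
  by exists b; rewrite splitAlg_algE.
have fixedW := fixed_base_change f_monic f_deg fixedC.
rewrite (splitRingP f_monic f_deg) in fixedW.
apply/eqP; apply: contraT => a_neq0.
pose c := splitEmb n f a.
have c2 : c *+ 2 = 0 by rewrite -rmorphMn a2 rmorph0.
have c_neq0 : c != 0.
  apply: contraNneq a_neq0; rewrite -(rmorph0 (splitEmb n f)).
  by move/splitEmb_inj->.
have cD : c * splitDR n f = 0 by apply: aD.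
have [b [i [_ cb_neq0 cbD]]] := annihilated_factor c_neq0 cD.
have [b' [j [lt_ij cbb_neq0 cbb_ij]]] := annihilated_factor cb_neq0 cbD.
case/eqP: cbb_neq0; move: b b' i j cb_neq0 cbD lt_ij cbb_ij.
case: n f f_monic f_deg {inv_base hn aD fixedC c_neq0 cD} c c2 fixedW
  => [|[|N]] g g_monic g_size c c2 fixedW b b' i j _ _ lt_ij cbb_ij.
- by have := ltn_ord i.
- by rewrite !ord1 in lt_ij.
apply: (annihilator_split (i0 := i) (j0 := j) fixedW).
- by rewrite -!mulrnAl c2 !mul0r.
- by rewrite neq_ltn lt_ij.
have cbb2 : c * b * b' *+ 2 = 0 by rewrite -!mulrnAl c2 !mul0r.
by rewrite mulrBr (eq_of_add_char2 cbb2 cbb_ij) subrr.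
Qed.
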